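(* Let $d\geq 2$. The operator system $\mathrm{Decomp}_d=(\mathrm{Decomp}_{d,s})_{s\geq 1}$ of decomposable matrices does not admit a finite-dimensional realization, and the operator system $\mathrm{Dpsd}_d=(\mathrm{Dpsd}_{d,s})_{s\geq 1}$ of doubly positive matrices is not finitely generated.
   Context: Here $\geqslant 0$ means (Hermitian) positive semidefinite, and $\mathrm{Her}_s(\mathbb{C})$ is the real space of Hermitian $s\times s$ matrices. Let $\mathcal{V}$ be a finite-dimensional $\mathbb{C}$-vector space with involution $*$ and real subspace $\mathcal{V}_h$ of Hermitian elements; $\mathrm{Mat}_s(\mathcal{V})=\mathcal{V}\otimes_{\mathbb{C}}\mathrm{Mat}_s(\mathbb{C})$ carries the involution $(v_{ij})^*_{i,j}=(v_{ji}^* )_{i,j}$. An abstract operator system $\mathcal{C}$ on $\mathcal{V}$ consists of a closed and salient (i.e. $\mathcal{C}_s\cap(-\mathcal{C}_s)=\{0\}$) convex cone $\mathcal{C}_s\subseteq \mathrm{Mat}_s(\mathcal{V})_h$ for each $s\geq 1$, and some $u\in\mathcal{C}_1$, such that (1) $A\in\mathcal{C}_s$, $V\in\mathrm{Mat}_{s,t}(\mathbb{C})$ imply $V^*AV\in\mathcal{C}_t$, and (2) $u\otimes I_s$ is an order unit (equivalently, an interior point) of $\mathcal{C}_s$ for all $s\ge 1$. $\mathcal{C}$ admits a finite-dimensional realization (is finite-dimensional realizable) if there are a finite-dimensional Hilbert space $\mathcal{H}$ and a $*$-linear map $\varphi:\mathcal{V}\to\mathbb{B}(\mathcal{H})$ with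 $\varphi(u)=\mathrm{id}_{\mathcal{H}}$ such that for all $s\geq 1$ and all $A\in\mathrm{Mat}_s(\mathcal{V})_h$: $A\in\mathcal{C}_s\Leftrightarrow(\varphi\otimes\mathrm{id})(A)\geqslant 0$. $\mathcal{C}$ is finitely generated if there are finitely many elements $A^{(1)},\ldots,A^{(n)}$, each belonging to some level $\mathcal{C}_s$, such that $\mathcal{C}$ is the smallest (with respect to level-wise inclusion) operator system on $\mathcal{V}$ containing all $A^{(j)}$. In the theorem, $\mathcal{V}=\mathrm{Mat}_d(\mathbb{C})$ with the usual conjugate-transpose involution, $u=I_d$, and $\mathrm{Mat}_s(\mathcal{V})=\mathrm{Mat}_d(\mathbb{C})\otimes\mathrm{Mat}_s(\mathbb{C})=\mathrm{Mat}_{ds}(\mathbb{C})$. The action is $V^*AV:=(I_d\otimes V)^*A(I_d\otimes V)$ for $V\in \mathrm{Mat}_{s,t}(\mathbb{C})$. The partial transpose is the linear map with $(A\otimes B)^\Gamma=A^T\otimes B$. For $s\geq 1$ set: - $\mathrm{Psd}_{d,s}=\{X\in\mathrm{Mat}_d(\mathbb{C})\otimes\mathrm{Mat}_s(\mathbb{C}) \mid X\geqslant 0\}$; - $\mathrm{Psd}^\Gamma_{d,s}=\{X\in\mathrm{Mat}_d(\mathbb{C})\otimes\mathrm{Mat}_s(\mathbb{C}) \mid X^\Gamma\geqslant 0\}$; - $\mathrm{Dpsd}_{d,s}=\mathrm{Psd}_{d,s}\cap\mathrm{Psd}^\Gamma_{d,s}$; - $\mathrm{Decomp}_{d,s}=\{X+Y\mid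 X\in\mathrm{Psd}_{d,s},\ Y\in\mathrm{Psd}^\Gamma_{d,s}\}$. These families are abstract operator systems. *)

(* Defs.v *)
From HB Require Import structures.
From mathcomp Require Import all_boot all_order all_algebra.
From mathcomp Require Import spectral sesquilinear.
From mathcomp Require Import all_classical all_reals all_analysis.
From mathcomp Require Import complex.
From mathcomp Require mxtens.

Set Implicit Arguments.
Unset Strict Implicit.
Unset Printing Implicit Defensive.

Import Order.TTheory GRing.Theory Num.Theory.
Import numFieldNormedType.Exports.
Import VectorInternalTheory.

Local Open Scope classical_set_scope.
Local Open Scope ring_scope.
Local Open Scope complex_scope.
Local Open Scope sesquilinear_scope.

Record starVect (R : realType) := StarVect {
  starVect_space :> vectType R[i];
  star : starVect_space -> starVect_space;
  starD : forall x y, star (x + y) = star x + star y;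
  starZ : forall (c : R[i]) x, star (c *: x) = c^* *: star x;
  starK : forall x, star (star x) = x }.

Arguments star {R s} x.

Section OperatorSystems.
Variables (R : realType) (V : starVect R).

(* Mat_s(V) is 'M[V]_s, the matrices with entries in V. *)

Definition mstar s (A : 'M[V]_s) : 'M[V]_s := \matrix_(i, j) star (A j i).

Definition tens s (v : V) (B : 'M[R[i]]_s) : 'M[V]_s :=
  \matrix_(i, j) (B i j *: v).

(* W^* A W *)
Definition compress s t (W : 'M[R[i]]_(s, t)) (A : 'M[V]_s) : 'M[V]_t :=
  \matrix_(i, j) \sum_k \sum_l ((W k i)^* * W l j) *: A k l.

(* The finite-dimensional space V carries no topology of its own, so closedness
   in Mat_s(V) is read off in coordinates; R[i]^o is R[i] with the topology of
   its modulus. *)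
Definition coordmx s (A : 'M[V]_s) : 'M['rV[R[i]^o]_(dim V)]_s :=
  map_mx (v2r : V -> 'rV[R[i]]_(dim V)) A.

(* Only the levels s >= 1 of a family are meaningful. *)
Definition conefamily := forall s : nat, set 'M[V]_s.

Record is_operator_system (C : conefamily) (u : V) : Prop := IsOperatorSystem {
  opsys_herm : forall s (A : 'M[V]_s), (0 < s)%N -> C s A -> mstar A = A;
  opsys_closed : forall s, (0 < s)%N -> closed [set coordmx A | A in C s];
  opsys_add : forall s (A B : 'M[V]_s), (0 < s)%N ->
    C s A -> C s B -> C s (A + B);
  opsys_scale : forall s (r : R) (A : 'M[V]_s), (0 < s)%N ->
    0 <= r -> C s A -> C s (map_mx (fun v => r%:C *: v) A);
  opsys_salient : forall s (A : 'M[V]_s), (0 < s)%N ->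
    C s A -> C s (- A) -> A = 0;
  opsys_unit : C 1%N (tens u 1%:M);
  opsys_compress : forall s t (W : 'M[R[i]]_(s, t)) (A : 'M[V]_s),
    (0 < s)%N -> (0 < t)%N -> C s A -> C t (compress W A);
  opsys_order_unit : forall s (A : 'M[V]_s), (0 < s)%N -> mstar A = A ->
    exists2 r : R, 0 < r & C s (tens u r%:C%:M + A) }.

Definition contains_generators (C : conefamily) n (sz : 'I_n -> nat)
    (A : forall j : 'I_n, 'M[V]_(sz j)) : Prop :=
  forall j, C (sz j) (A j).

(* As the order unit is part of the data of an operator system, each
   competitor D comes with an order unit of its own. *)
Definition finitely_generated (C : conefamily) (u : V) : Prop :=
  exists (n : nat) (sz : 'I_n -> nat) (A : forall j : 'I_n, 'M[V]_(sz j)),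
    [/\ forall j, (0 < sz j)%N,
        is_operator_system C u,
        contains_generators C A &
        forall (D : conefamily) (u' : V), is_operator_system D u' ->
          contains_generators D A ->
          forall s, (0 < s)%N -> C s `<=` D s].

End OperatorSystems.

Section Matrices.
Variable R : realType.

Definition psdmx n (A : 'M[R[i]]_n) : Prop :=
  A^t* = A /\ forall x : 'cV[R[i]]_n, 0 <= (x^t* *m A *m x) 0 0.

Lemma adjmxD m d (A B : 'M[R[i]]_(m, d)) : (A + B)^t* = A^t* + B^t*.
Proof. by apply/matrixP => i j; rewrite !mxE rmorphD. Qed.

Lemma adjmxZ d (c : R[i]) (A : 'M[R[i]]_d) : (c *: A)^t* = c^* *: A^t*.
Proof. by apply/matrixP => i j; rewrite !mxE rmorphM. Qed.

Lemma adjmxK d (A : 'M[R[i]]_d) : (A^t*)^t* = A.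
Proof. exact: trmxCK. Qed.

(* Mat_d(C) with the conjugate transpose *)
Definition Mat (d : nat) : starVect R :=
  @StarVect R 'M[R[i]]_d (fun A => A^t*)
    (@adjmxD d d) (@adjmxZ d) (@adjmxK d).

(* The identification Mat_s(Mat_d(C)) = Mat_d(C) (x) Mat_s(C) = Mat_(ds)(C),
   for the Kronecker product of mxtens; see kron_tens. *)
Definition kron d s (X : 'M[Mat d]_s) : 'M[R[i]]_(d * s) :=
  \matrix_(p, q) (X (mxtens.mxtens_unindex p).2 (mxtens.mxtens_unindex q).2
                  : 'M[R[i]]_d)
    (mxtens.mxtens_unindex p).1 (mxtens.mxtens_unindex q).1.

(* (A (x) B)^Gamma = A^T (x) B; see ptrans_tens. *)
Definition ptrans d s (X : 'M[Mat d]_s) : 'M[Mat d]_s :=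
  map_mx (fun A : 'M[R[i]]_d => A^T) X.

Definition Psd d : conefamily (Mat d) := fun s X => psdmx (kron X).

Definition PsdG d : conefamily (Mat d) := fun s X => psdmx (kron (ptrans X)).

Definition Dpsd d : conefamily (Mat d) := fun s => @Psd d s `&` @PsdG d s.

Definition Decomp d : conefamily (Mat d) := fun s =>
  [set Z | exists X Y, [/\ @Psd d s X, @PsdG d s Y & Z = X + Y]].

(* The finite-dimensional Hilbert space is C^m, with B(C^m) = Mat_m(C). *)
Definition fd_realizable (V : starVect R) (C : conefamily V) (u : V) : Prop :=
  exists (m : nat) (phi : {linear V -> 'M[R[i]]_m}),
    [/\ forall v, phi (star v) = (phi v)^t*,
        phi u = 1%:M &
        forall s (A : 'M[V]_s), (0 < s)%N -> mstar A = A ->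
          (C s A <-> psdmx (kron (map_mx phi A : 'M[Mat m]_s)))].

Lemma kron_tens d s (A : 'M[R[i]]_d) (B : 'M[R[i]]_s) :
  kron (tens (A : Mat d) B) = mxtens.tensmx A B.
Proof. by apply/matrixP => p q; rewrite !mxE mulrC. Qed.

Lemma ptrans_tens d s (A : 'M[R[i]]_d) (B : 'M[R[i]]_s) :
  ptrans (tens (A : Mat d) B) = tens (A^T : Mat d) B.
Proof. by apply/matrixP => i j; rewrite !mxE; apply/matrixP => k l; rewrite !mxE. Qed.

Lemma kron_mstar d s (X : 'M[Mat d]_s) : kron (mstar X) = (kron X)^t*.
Proof. by apply/matrixP => p q; rewrite !mxE. Qed.

Lemma sum_mxtens d s (F : 'I_(d * s) -> R[i]) :
  \sum_p F p = \sum_a \sum_k F (mxtens.mxtens_index (a, k)).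
Proof.
rewrite pair_big (reindex (@mxtens.mxtens_index d s)) /=.
  by apply: eq_bigr => -[].
by exists (@mxtens.mxtens_unindex d s) => i _;
  rewrite ?mxtens.mxtens_indexK ?mxtens.mxtens_unindexK.
Qed.

Lemma kron_compress d s t (W : 'M[R[i]]_(s, t)) (X : 'M[Mat d]_s) :
  kron (compress W X) =
  (mxtens.tensmx (1%:M : 'M[R[i]]_d) W)^t* *m kron X
    *m mxtens.tensmx (1%:M : 'M[R[i]]_d) W.
Proof.
apply/matrixP => p q.
case: (mxtens.mxtens_indexP p) => a i; case: (mxtens.mxtens_indexP q) => b j.
rewrite !mxE !mxtens.mxtens_indexK /= summxE sum_mxtens (bigD1 b) //=.
rewrite [X in _ + X]big1 ?addr0 => [|b' /negPf b'b]; last first.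
  by apply: big1 => l _; rewrite mxtens.tensmxE [1%:M _ _]mxE b'b mul0r mulr0.
under eq_bigr do rewrite summxE.
rewrite exchange_big /=; apply: eq_bigr => l _.
rewrite mxtens.tensmxE [1%:M _ _]mxE eqxx mul1r mxE sum_mxtens (bigD1 a) //=.
rewrite [X in _ + X]big1 ?addr0 => [|a' /negPf a'a]; last first.
  by apply: big1 => k _; rewrite !mxE !mxtens.mxtens_indexK /= a'a mul0r rmorph0 mul0r.
rewrite mulr_suml; apply: eq_bigr => k _.
rewrite !mxE !mxtens.mxtens_indexK /= eqxx mul1r mulrAC //.
Qed.

Lemma psdmxD n (A B : 'M[R[i]]_n) : psdmx A -> psdmx B -> psdmx (A + B).
Proof.
move=> [hA pA] [hB pB]; split=> [|x]; first by rewrite adjmxD hA hB.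
by rewrite mulmxDr mulmxDl mxE addr_ge0.
Qed.

Lemma psdmxZ n (r : R) (A : 'M[R[i]]_n) :
  0 <= r -> psdmx A -> psdmx (r%:C *: A).
Proof.
move=> r0 [hA pA]; have c0 : 0 <= r%:C by rewrite ler0c.
split=> [|x]; first by rewrite adjmxZ hA geC0_conj.
by rewrite -scalemxAr -scalemxAl mxE mulr_ge0.
Qed.

Lemma adjmxM m n p (A : 'M[R[i]]_(m, n)) (B : 'M[R[i]]_(n, p)) :
  (A *m B)^t* = B^t* *m A^t*.
Proof. by rewrite trmx_mul map_mxM. Qed.

Lemma psdmx_congr m n (A : 'M[R[i]]_m) (W : 'M[R[i]]_(m, n)) :
  psdmx A -> psdmx (W^t* *m A *m W).
Proof.
move=> [hA pA]; split=> [|x]; first by rewrite !adjmxM hA trmxCK mulmxA.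
by have := pA (W *m x); rewrite adjmxM !mulmxA.
Qed.

Lemma normsq_mxE n (x : 'cV[R[i]]_n) : (x^t* *m x) 0 0 = \sum_p `|x p 0| ^+ 2.
Proof. by rewrite mxE; apply: eq_bigr => p _; rewrite !mxE mulrC -normCK. Qed.

Lemma psdmx1 n : psdmx (1%:M : 'M[R[i]]_n).
Proof.
split=> [|x]; first by rewrite trmx1 map_mx1.
by rewrite mulmx1 normsq_mxE sumr_ge0 // => p _; rewrite exprn_ge0.
Qed.

Lemma psdmx_salient n (A : 'M[R[i]]_n) : psdmx A -> psdmx (- A) -> A = 0.
Proof.
move=> [hA pA] [_ nA].
have q0 (x : 'cV[R[i]]_n) : (x^t* *m A *m x) 0 0 = 0.
  apply/eqP; rewrite eq_le pA andbT -oppr_ge0.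
  by have := nA x; rewrite mulmxN mulNmx mxE.
have Ax0 (x : 'cV[R[i]]_n) : A *m x = 0.
  have := q0 (A *m x + x).
  have addE (M N : 'M[R[i]]_1) : (M + N) 0 0 = M 0 0 + N 0 0 by rewrite mxE.
  rewrite adjmxD !(mulmxDl, mulmxDr) !addE !q0 add0r addr0 adjmxM hA -!mulmxA => /eqP.
  rewrite -mulr2n mulrn_eq0 /= => /eqP.
  have -> : x^t* *m (A *m (A *m x)) = (A *m x)^t* *m (A *m x).
    by rewrite adjmxM hA !mulmxA.
  rewrite normsq_mxE => /eqP; rewrite psumr_eq0 => [/allP z|p _]; last exact: exprn_ge0.
  apply/colP => p; rewrite [RHS]mxE; apply/eqP.
  by have := z p (mem_index_enum p); rewrite /= sqrf_eq0 normr_eq0.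
by apply/matrixP => p q; have /colP/(_ p) := Ax0 (delta_mx q 0); rewrite -colE !mxE.
Qed.

Lemma psdmx_order_unit n (A : 'M[R[i]]_n) : A^t* = A ->
  exists2 r : R, 0 < r & psdmx (r%:C%:M + A).
Proof.
move=> hA; pose B : R[i] := \sum_p \sum_q `|A p q|.
have B0 : 0 <= B by rewrite sumr_ge0 // => p _; rewrite sumr_ge0.
have BE : B = (complex.Re B)%:C by rewrite [LHS]complexE (ger0_Im B0) mulr0 addr0.
exists (1 + complex.Re B).
  by rewrite ltr_pwDl // -ler0c -BE.
split=> [|x].
  rewrite adjmxD hA; congr (_ + _); rewrite tr_scalar_mx map_scalar_mx /=.
  by congr (_%:M); rewrite geC0_conj // ler0c addr_ge0 // -ler0c -BE.
pose N : R[i] := \sum_p `|x p 0| ^+ 2.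
have N0 : 0 <= N by rewrite sumr_ge0 // => p _; rewrite exprn_ge0.
set S := (x^t* *m A *m x) 0 0.
have Sreal : S \is Num.real.
  rewrite CrealE /S -[X in X == _]/(((x^t* *m A *m x) 0 0)^*).
  have {2}-> : x^t* *m A *m x = (x^t* *m A *m x)^t*.
    by rewrite !adjmxM hA trmxCK mulmxA.
  by rewrite !mxE.
have xle p : `|x p 0| ^+ 2 <= N.
  by rewrite /N (bigD1 p) //= lerDl sumr_ge0 // => q _; rewrite exprn_ge0.
have xxle p q : `|x p 0| * `|x q 0| <= N.
  have [pq|qp] := real_leP (normr_real (x p 0)) (normr_real (x q 0)).
    by apply: le_trans (xle q); rewrite expr2 ler_wpM2r.
  by apply: le_trans (xle p); rewrite expr2 ler_wpM2l // ltW.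
have SB : `|S| <= B * N.
  rewrite /S mxE; under eq_bigr do rewrite mxE mulr_suml.
  apply: le_trans (ler_norm_sum _ _ _) _; rewrite /B.
  rewrite exchange_big /= mulr_suml; apply: ler_sum => q _.
  apply: le_trans (ler_norm_sum _ _ _) _; rewrite mulr_suml.
  apply: ler_sum => p _; rewrite !mxE !normrM norm_conjC mulrAC mulrC.
  by rewrite ler_wpM2l.
rewrite mulmxDr mulmxDl mxE -/S mul_mx_scalar -scalemxAl mxE normsq_mxE -/N.
rewrite rmorphD rmorph1 /= -BE mulrDl mul1r -addrA addr_ge0 //.
rewrite -lerBlDr sub0r (le_trans _ SB) // -normrN.
by rewrite real_ler_norm // realN.
Qed.

End Matrices.

Lemma conj_continuous (K : numClosedFieldType) : continuous (Num.conj : K^o -> K^o).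
Proof.
move=> z P [e e0 zP]; exists e => // w /= zw; apply: zP => /=.
by rewrite -rmorphB norm_conjC.
Qed.

Lemma sum_continuous (K : numFieldType) (T : topologicalType) (I : Type) (r : seq I)
  (F : I -> T -> K^o) :
  (forall i, continuous (F i)) -> continuous (fun M => \sum_(i <- r) F i M).
Proof.
move=> cF; elim: r => [|i r ih].
  by under eq_fun do rewrite big_nil; move=> M; exact: cvg_cst.
under eq_fun do rewrite big_cons.
by move=> M; apply: (@continuousD K K^o); [exact: cF|exact: ih].
Qed.

Lemma closed_psdmx_gen (K : numClosedFieldType) (T : topologicalType) n (E : T -> 'M[K]_n) :
  (forall p q, continuous (fun M => E M p q : K^o)) ->
  closed [set M | (E M)^t* = E M /\ forall x : 'cV_n, 0 <= (x^t* *m E M *m x) 0 0].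
Proof.
move=> cE.
have closed_eqC (f g : T -> K^o) : continuous f -> continuous g ->
    closed [set M | f M = g M].
  move=> cf cg; rewrite (_ : [set _ | _] = (fun M => f M - g M) @^-1` [set 0]).
    apply: (@closed_comp T K^o) => [M _|].
      by apply: (@continuousB K K^o); [exact: cf|exact: cg].
    apply/accessible_closed_set1/hausdorff_accessible.
    exact: (@norm_hausdorff K K^o).
  apply/seteqP; split=> M /=; first by move=> ->; rewrite subrr.
  by move=> /eqP; rewrite subr_eq0 => /eqP.
have cq (x : 'cV[K]_n) : continuous (fun M => (x^t* *m E M *m x) 0 0 : K^o).
  under eq_fun do rewrite mxE.
  apply: sum_continuous => q; under eq_fun do rewrite mxE.
  move=> M; apply: (@continuousM K T); last exact: cvg_cst.
  apply: sum_continuous => p {}M.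
  by apply: (@continuousM K T); [exact: cvg_cst|exact: cE].
rewrite (_ : [set _ | _] =
    \bigcap_(pq in [set: 'I_n * 'I_n]) [set M | Num.conj (E M pq.2 pq.1) = E M pq.1 pq.2]
    `&` \bigcap_(x in [set: 'cV[K]_n])
      [set M | `|(x^t* *m E M *m x) 0 0| = (x^t* *m E M *m x) 0 0]).
  apply: closedI; apply: closed_bigI; [move=> [p q]|move=> x]; move=> _ /=; apply: closed_eqC => //.
  - by move=> M; apply: (@continuous_comp T K^o K^o); first exact: cE; exact: conj_continuous.
  - by move=> M; apply: (@continuous_comp T K^o K^o); first exact: cq; exact: (@norm_continuous K K^o).
apply/seteqP; split=> M /= [hM pM]; split.
- by move=> [p q] _ /=; have /matrixP/(_ p q) := hM; rewrite !mxE.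
- by move=> x _ /=; apply/ger0_norm/pM.
- by apply/matrixP => p q; rewrite !mxE; exact: (hM (p, q) I).
- by move=> x; rewrite -(pM x I).
Qed.

Lemma closed_psdmx (R : realType) (T : topologicalType) n (E : T -> 'M[R[i]]_n) :
  (forall p q, continuous (fun M => E M p q : R[i]^o)) ->
  closed [set M | psdmx (E M)].
Proof. exact: closed_psdmx_gen. Qed.

Lemma entry_continuous (T : topologicalType) m n (i : 'I_m) (j : 'I_n) :
  continuous (fun M : 'M[T]_(m, n) => M i j).
Proof.
move=> M P /= MP; exists (fun i' j' => if (i' == i) && (j' == j) then P else setT).
  move=> i' j'; case: ifP => [/andP[/eqP -> /eqP ->] //|_]; exact: filterT.
by move=> N /(_ i j); rewrite !eqxx.
Qed.

Lemma vcoord_continuous (K : numFieldType) (V : vectType K) s (f : {linear V -> K^o}) i j :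
  continuous (fun M : 'M['rV[K^o]_(dim V)]_s => f (r2v (M i j : 'rV[K]_(dim V))) : K^o).
Proof.
have E (v : 'rV[K]_(dim V)) : f (r2v v) = \sum_k v 0 k * f (r2v (delta_mx 0 k)).
  rewrite {1}[v]row_sum_delta !linear_sum; apply: eq_bigr => k _.
  by rewrite linearZ linearZ.
under eq_fun do rewrite E.
apply: sum_continuous => k M.
have c1 : {for M, continuous (fun M : 'M['rV[K^o]_(dim V)]_s => M i j 0 k : K^o)}.
  exact: (continuous_comp (@entry_continuous 'rV[K^o]_(dim V) s s i j M)
            (@entry_continuous K^o _ _ 0 k (M i j))).
pose c : K^o := f (r2v (delta_mx 0 k)).
exact: (@continuousM K _ _ _ M c1 (@cst_continuous _ K^o c M)).
Qed.

Section Dpsd.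
Variables (R : realType) (d : nat).
Implicit Types s t : nat.

Lemma kronD s (X Y : 'M[Mat R d]_s) : kron (X + Y) = kron X + kron Y.
Proof. by apply/matrixP => p q; rewrite !mxE. Qed.
Lemma kronN s (X : 'M[Mat R d]_s) : kron (- X) = - kron X.
Proof. by apply/matrixP => p q; rewrite !mxE. Qed.
Lemma kronZ s (c : R[i]) (X : 'M[Mat R d]_s) :
  kron (map_mx (fun v => c *: v) X) = c *: kron X.
Proof. by apply/matrixP => p q; rewrite !mxE. Qed.
Lemma kron_inj s (X : 'M[Mat R d]_s) : kron X = 0 -> X = 0.
Proof.
move=> /matrixP X0; apply/matrixP => i j; rewrite mxE; apply/matrixP => a b.
have := X0 (mxtens.mxtens_index (a, i)) (mxtens.mxtens_index (b, j)).
by rewrite !mxE !mxtens.mxtens_indexK /= => ->.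
Qed.
Lemma ptransD s (X Y : 'M[Mat R d]_s) : ptrans (X + Y) = ptrans X + ptrans Y.
Proof. by apply/matrixP => i j; rewrite !mxE; apply/matrixP => a b; rewrite !mxE. Qed.
Lemma ptransN s (X : 'M[Mat R d]_s) : ptrans (- X) = - ptrans X.
Proof. by apply/matrixP => i j; rewrite !mxE; apply/matrixP => a b; rewrite !mxE. Qed.
Lemma ptransZ s (c : R[i]) (X : 'M[Mat R d]_s) :
  ptrans (map_mx (fun v => c *: v) X) = map_mx (fun v => c *: v) (ptrans X).
Proof. by apply/matrixP => i j; rewrite !mxE; apply/matrixP => a b; rewrite !mxE. Qed.
Lemma ptrans_mstar s (X : 'M[Mat R d]_s) : ptrans (mstar X) = mstar (ptrans X).
Proof. by apply/matrixP => i j; rewrite !mxE; apply/matrixP => a b; rewrite !mxE. Qed.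
Lemma ptrans_compress s t (W : 'M[R[i]]_(s, t)) (X : 'M[Mat R d]_s) :
  ptrans (compress W X) = compress W (ptrans X).
Proof.
apply/matrixP => i j; rewrite !mxE; apply/matrixP => a b; rewrite mxE !summxE.
apply: eq_bigr => k _; rewrite !summxE; apply: eq_bigr => l _.
by rewrite !mxE.
Qed.

Lemma psdmx_compress s t (W : 'M[R[i]]_(s, t)) (X : 'M[Mat R d]_s) :
  psdmx (kron X) -> psdmx (kron (compress W X)).
Proof. by rewrite kron_compress; exact: psdmx_congr. Qed.

Lemma kron_unit s (c : R[i]) : kron (tens (1%:M : Mat R d) (c%:M : 'M[R[i]]_s)) = c%:M.
Proof.
apply/matrixP => p q; case: (mxtens.mxtens_indexP p) => a i; case: (mxtens.mxtens_indexP q) => b j.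
rewrite !mxE !mxtens.mxtens_indexK /=  (can_eq (@mxtens.mxtens_indexK d s)) xpair_eqE.
by case: (a == b); case: (i == j); rewrite /= ?(mulr1, mulr0).
Qed.

Lemma entry_kron_continuous s (i j : 'I_s) (a b : 'I_d) :
  continuous (fun M : 'M['rV[R[i]^o]_(dim (Mat R d))]_s =>
    (r2v (M i j : 'rV[R[i]]_(dim (Mat R d))) : 'M[R[i]]_d) a b : R[i]^o).
Proof.
pose f (A : Mat R d) : R[i]^o := (A : 'M[R[i]]_d) a b.
have fl : linear f by move=> c A B; rewrite /f !mxE.
pose F : {linear Mat R d -> R[i]^o} := HB.pack f (GRing.isLinear.Build _ _ _ _ f fl).
exact: (@vcoord_continuous R[i] (Mat R d) s F).
Qed.

Lemma Dpsd_is_operator_system :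
  is_operator_system (@Dpsd R d) (1%:M : Mat R d).
Proof.
split.
- move=> s A _ [[hA _] _]; have /kron_inj/eqP : kron (mstar A - A) = 0.
    by rewrite kronD kronN kron_mstar hA subrr.
  by rewrite subr_eq0 => /eqP.
- move=> s _; rewrite (_ : [set _ | _ in _] =
    [set M : 'M['rV[R[i]^o]_(dim (Mat R d))]_s | psdmx (kron (map_mx (r2v : _ -> Mat R d) M))] `&`
    [set M : 'M['rV[R[i]^o]_(dim (Mat R d))]_s | psdmx (kron (ptrans (map_mx (r2v : _ -> Mat R d) M)))]).
    apply: closedI; apply: closed_psdmx => p q.
      under eq_fun do rewrite !mxE; exact: entry_kron_continuous.
    under eq_fun do rewrite !mxE; exact: entry_kron_continuous.
  have K1 A : map_mx (r2v : _ -> Mat R d) (coordmx A) = A :> 'M[Mat R d]_s.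
    by apply/matrixP => i j; rewrite !mxE v2rK.
  apply/seteqP; split=> M /=; first by move=> [A [pA gA] <-]; rewrite K1.
  move=> [pM gM]; exists (map_mx (r2v : _ -> Mat R d) M); first exact: conj pM gM.
  by apply/matrixP => i j; rewrite !mxE r2vK.
- move=> s A B _ [pA gA] [pB gB]; split.
    by rewrite /Psd kronD; exact: psdmxD pA pB.
  by rewrite /PsdG ptransD kronD; exact: psdmxD gA gB.
- move=> s r A _ r0 [pA gA]; split.
    by rewrite /Psd kronZ; exact: psdmxZ r0 pA.
  by rewrite /PsdG ptransZ kronZ; exact: psdmxZ r0 gA.
- move=> s A _ [pA _] [nA _]; apply: kron_inj; apply: (psdmx_salient pA).
  by rewrite -kronN; exact: nA.
- split; first by rewrite /Psd kron_unit; exact: psdmx1.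
  by rewrite /PsdG ptrans_tens trmx1 kron_unit; exact: psdmx1.
- move=> s t W A _ _ [pA gA]; split; first by rewrite /Psd; exact: (@psdmx_compress s t W A pA).
  by rewrite /PsdG ptrans_compress; exact: (@psdmx_compress s t W (ptrans A) gA).
- move=> s A _ hA.
  have h1 : (kron A)^t* = kron A by rewrite -kron_mstar hA.
  have h2 : (kron (ptrans A))^t* = kron (ptrans A) by rewrite -kron_mstar -ptrans_mstar hA.
  have [r r0 pr] := psdmx_order_unit h1; have [t t0 pt] := psdmx_order_unit h2.
  have sc n (x y : R) (B : 'M[R[i]]_n) : 0 <= y -> psdmx (x%:C%:M + B) -> psdmx ((x + y)%:C%:M + B).
    move=> y0 pB; rewrite rmorphD raddfD /= addrAC; apply: psdmxD => //.
    by rewrite -scalemx1; apply: psdmxZ => //; exact: psdmx1.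
  exists (r + t); first exact: addr_gt0.
  split.
    by rewrite /Psd kronD kron_unit; apply: sc pr; exact: ltW.
  rewrite /PsdG ptransD ptrans_tens trmx1 kronD kron_unit [r + t]addrC.
  by apply: sc pt; exact: ltW.
Qed.
End Dpsd.

(* Main.v *)
(* Fix two indices and write [X00, X01, X10, X11] for the corresponding corner of
   [X].  For real [t] and [e > 0] the functional
     [psi X = X00 - t (X01 + X10) + (t^2 - e) X11]
   is negative on the rank-one matrix of the vector [(t, 1)].  If [A] is doubly
   positive, the block matrix [[P, h], [h, Q]] with [P = 2 A00], [h = A01 + A10],
   [Q = 2 A11] is positive, hence so is [K = P - 2 t h + t^2 Q], and every
   [v] in its kernel satisfies [h v = t Q v].  Unless [t] is one of finitely many
   generalized eigenvalues of [(h, Q)], this forces [Q v = 0], so [K] dominates a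
   positive multiple of [Q], that is, [psi A >= 0] for all small [e].

   Given finitely many generators of Dpsd, one pair [(t, e)] works for all of them,
   and the doubly positive [X] with [psi X >= 0] form an operator system that
   contains the generators but not Dpsd at level 1.  A finite-dimensional
   realization [phi] of Decomp has a doubly positive Choi matrix, and then [phi]
   is positive at the matrix of [psi], which is not decomposable. *)
From HB Require Import structures.
Require Import Defs.
From mathcomp Require Import all_boot all_order all_algebra all_reals.
From mathcomp Require Import ring lra.
From mathcomp Require Import complex.
From mathcomp Require Import spectral sesquilinear.
From mathcomp Require Import all_classical all_analysis.
From mathcomp Require mxtens.
Set Implicit Arguments.
Unset Strict Implicit.
Unset Printing Implicit Defensive.
Import GRing.Theory.
Import Order.TTheory Num.Theory.
Import VectorInternalTheory.
Local Open Scope classical_set_scope.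
Local Open Scope ring_scope.
Local Open Scope complex_scope.
Local Open Scope sesquilinear_scope.

(** * Positive semidefinite matrices: kernels, domination, block pencils *)

Lemma half_pencilE (F : numFieldType) (V : lmodType F) (P h Q : V) (t e e0 : F) :
  2^-1 *: (P + P - t *: h - t *: h + t ^+ 2 *: (Q + Q) - e0 *: (Q + Q)
    + (e0 - e) *: (Q + Q)) = P - t *: h + (t ^+ 2 - e) *: Q.
Proof.
rewrite -addrA -[- (e0 *: _)]scaleNr -scalerDl -addrA -scalerDl addKr.
have -> : P + P - t *: h - t *: h = (P - t *: h) *+ 2.
  by rewrite mulr2n addrACA addrA.
by rewrite -mulr2n -scalerMnr -mulrnDl -scaler_nat scalerA mulVf ?scale1r ?pnatr_eq0.
Qed.

Section Psd.
Variable R : realType.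
Implicit Types (n m : nat) (r t e : R).

Lemma psdmx_herm n (A : 'M[R[i]]_n) : psdmx A -> A^t* = A.
Proof. by case. Qed.

Lemma adjmxN m n (A : 'M[R[i]]_(m, n)) : (- A)^t* = - A^t*.
Proof. by apply/matrixP => i j; rewrite !mxE rmorphN. Qed.

(** Congruence by the 0-1 matrix whose columns are the basis vectors picked by [f]; repetitions are
    allowed. *)
Lemma psdmx_mxsub m n (f : 'I_m -> 'I_n) (A : 'M[R[i]]_n) :
  psdmx A -> psdmx (mxsub f f A).
Proof.
move=> pA; pose W : 'M[R[i]]_(n, m) := colsub f 1%:M.
have WE : W^t* = rowsub f 1%:M.
  by apply/matrixP => i j; rewrite !mxE eq_sym; case: eqP; rewrite ?rmorph1 ?rmorph0.
have -> : mxsub f f A = W^t* *m A *m W; last exact: psdmx_congr.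
by rewrite WE mul_rowsub_mx mul1mx -mxsub_mul mulmx1.
Qed.

Lemma psdmx_gram m n (W : 'M[R[i]]_(m, n)) : psdmx (W^t* *m W).
Proof. by rewrite -[W^t*]mulmx1; apply/psdmx_congr/psdmx1. Qed.

(** Take [r] with [L = r - K] positive. Since [K] and [L] commute and sum to [r],
    [r K L = K L K + L K L], while [K L = r K - K^2]. *)
Lemma psdmx_sqr_le n (K : 'M[R[i]]_n) : psdmx K ->
  exists2 r, 0 < r & psdmx (r%:C *: K - K *m K).
Proof.
move=> pK; have hK := psdmx_herm pK.
have [r r0 pr] : exists2 r : R, 0 < r & psdmx (r%:C%:M - K).
  by apply: psdmx_order_unit; rewrite adjmxN hK.
have rC0 : r%:C != 0 by rewrite fmorph_eq0 gt_eqF.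
exists r; first exact: r0.
have hr := psdmx_herm pr.
have -> : r%:C *: K - K *m K =
    r^-1%:C *: (K^t* *m (r%:C%:M - K) *m K + (r%:C%:M - K)^t* *m K *m (r%:C%:M - K)).
  rewrite hr hK fmorphV; set L := r%:C%:M - K.
  have KL : K *m L = r%:C *: K - K *m K by rewrite mulmxBr mul_mx_scalar.
  have LK : L *m K = K *m L by rewrite KL mulmxBl mul_scalar_mx.
  have -> : K *m L *m K + L *m K *m L = r%:C *: (K *m L).
    by rewrite LK -mulmxDr addrC subrK mul_mx_scalar.
  by rewrite scalerA mulVf // scale1r KL.
apply: psdmxZ; first by rewrite invr_ge0 ltW.
by apply: psdmxD; exact: psdmx_congr.
Qed.

(** By [psdmx_sqr_le], [|M x|^2 = x^* M^2 x <= r x^* M x = 0]. *)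
Lemma psdmx_kernel n (M : 'M[R[i]]_n) (x : 'cV[R[i]]_n) :
  psdmx M -> (x^t* *m M *m x) 0 0 = 0 -> M *m x = 0.
Proof.
move=> pM x0; have [r _ [_ /(_ x)]] := psdmx_sqr_le pM.
rewrite mulmxBr mulmxBl -scalemxAr -scalemxAl mxE [X in X + _]mxE x0 mulr0 add0r.
rewrite mxE.
have -> : x^t* *m (M *m M) *m x = (M *m x)^t* *m (M *m x).
  by rewrite adjmxM (psdmx_herm pM) !mulmxA.
rewrite normsq_mxE oppr_ge0 => le0.
have /eqP : \sum_p `|(M *m x) p 0| ^+ 2 = 0.
  by apply/eqP; rewrite eq_le le0 sumr_ge0 // => p _; rewrite exprn_ge0.
rewrite psumr_eq0 => [/allP z|p _]; last exact: exprn_ge0.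
apply/colP => p; rewrite [RHS]mxE; apply/eqP.
by have := z p (mem_index_enum p); rewrite /= sqrf_eq0 normr_eq0.
Qed.

(** The columns of [pinvmx K *m K - 1] lie in the kernel of [K], hence in that of [Q]. *)
Lemma sub_kernel_mulmx n m k (K : 'M[R[i]]_(m, n)) (Q : 'M[R[i]]_(k, n)) :
  (forall x : 'cV_n, K *m x = 0 -> Q *m x = 0) -> Q *m pinvmx K *m K = Q.
Proof.
move=> KQ; apply/eqP; rewrite -subr_eq0; apply/eqP/matrixP => a b.
set Z := _ - _.
have KZ : K *m (pinvmx K *m K - 1%:M) = 0.
  by rewrite mulmxBr mulmx1 mulmxA mulmxKpV // subrr.
have := KQ ((pinvmx K *m K - 1%:M) *m delta_mx b 0).
rewrite !mulmxA KZ mul0mx mulmxBr mulmx1 mulmxA -/Z -colE.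
by move=> /(_ erefl)/colP/(_ a); rewrite !mxE.
Qed.

Lemma psdmx_dominates n (K Q : 'M[R[i]]_n) :
  psdmx K -> Q^t* = Q -> (forall x : 'cV_n, K *m x = 0 -> Q *m x = 0) ->
  exists2 e, 0 < e & psdmx (K - e%:C *: Q).
Proof.
move=> pK hQ KQ; have hK := psdmx_herm pK.
move: (pinvmx K) (sub_kernel_mulmx KQ) => L QK.
pose B := L^t* *m Q *m L.
(* From [Q L K = Q] and its adjoint, [Q] is unchanged when sandwiched between [L K] and its
   adjoint. *)
have QE : Q = K^t* *m B *m K.
  have -> : K^t* *m B *m K = (L *m K)^t* *m (Q *m L *m K).
    by rewrite adjmxM !mulmxA.
  by rewrite QK -{2}hQ -adjmxM mulmxA QK hQ.
have hB : (- B)^t* = - B.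
  by rewrite adjmxN /B !adjmxM adjmxK hQ mulmxA.
have [r r0 pr] := psdmx_sqr_le pK.
have [s s0 ps] := psdmx_order_unit hB.
(* [Q = K B K <= s K^2] and [K^2 <= r K] *)
exists (r * s)^-1; first by rewrite invr_gt0 mulr_gt0.
have c0 (x : R) : 0 < x -> x%:C != 0.
  by move=> x0; rewrite fmorph_eq0 gt_eqF.
have -> : K - (r * s)^-1%:C *: Q =
   (r * s)^-1%:C *: (s%:C *: (r%:C *: K - K *m K) + K^t* *m (s%:C%:M - B) *m K).
  apply: (@scalerI _ _ (r * s)%:C); first by rewrite c0 // mulr_gt0.
  rewrite scalerBr !scalerA fmorphV divff ?c0 ?mulr_gt0 // !scale1r.
  rewrite mulmxBr mulmxBl -QE hK mul_mx_scalar -scalemxAl scalerBr scalerA.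
  by rewrite addrA subrK rmorphM mulrC.
apply: psdmxZ; first by rewrite invr_ge0 ltW // mulr_gt0.
by apply: psdmxD; [apply: psdmxZ => //; exact: ltW|exact: psdmx_congr].
Qed.

(** The kernel inclusion gives [h = h Q^+ Q] with [Q^+ = pinvmx Q], so [h v = t Q v] makes [Q v],
    unless zero, an eigenvector of [h Q^+] for [t]. The transpose accounts for [eigenvalue] using
    row vectors. *)
Lemma pencil_eigenvalue n (h Q : 'M[R[i]]_n) (t : R[i]) (v : 'cV_n) :
  (forall x : 'cV_n, Q *m x = 0 -> h *m x = 0) ->
  (h - t *: Q) *m v = 0 -> ~~ root (char_poly (h *m pinvmx Q)^T) t ->
  Q *m v = 0.
Proof.
move=> Qh hv nr; apply/eqP; apply: contraNT nr => Qv0.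
rewrite -eigenvalue_root_char; apply/eigenvalueP; exists (Q *m v)^T.
  rewrite -trmx_mul mulmxA sub_kernel_mulmx // -linearZ /= scalemxAl; congr trmx.
  by apply/eqP; rewrite -subr_eq0 -mulmxBl hv.
by rewrite -(inj_eq trmx_inj) trmxK trmx0.
Qed.

(** Serves both halves of the theorem: the blocks are corners of a doubly positive matrix, or images
    of matrix units under a realization. [p] is fixed before [t], so that finitely many block
    matrices can share one [t]; [e0] depends on [t]. *)
Lemma block_pencil_psd n (P C C' Q : 'M[R[i]]_n) :
  psdmx (block_mx P C C' Q) -> psdmx (block_mx P C' C Q) ->
  exists2 p : {poly R[i]}, p != 0 & forall t, ~~ root p t%:C ->
    exists2 e0, 0 < e0 & forall e, 0 <= e <= e0 ->
      psdmx (P - t%:C *: (C + C') + (t ^+ 2 - e)%:C *: Q).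
Proof.
move=> p1 p2; pose h := C + C'; pose M := block_mx (P + P) h h (Q + Q).
have pM : psdmx M.
  by have := psdmxD p1 p2; rewrite add_block_mx [C' + C]addrC.
have pQ : psdmx Q.
  have := psdmx_mxsub (@rshift n n) p1; congr psdmx.
  by apply/matrixP => a b; rewrite mxE block_mxEdr.
have pQ2 : psdmx (Q + Q) by exact: psdmxD.
(* If [Q x = 0], then [(0, x)] is isotropic for [M], hence in its kernel; the upper half of
   [M (0, x)] is [h x]. *)
have Qh (x : 'cV_n) : (Q + Q) *m x = 0 -> h *m x = 0.
  move=> Qx; suff /eqP : M *m col_mx 0 x = 0.
    by rewrite mul_block_col !mulmx0 !add0r col_mx_eq0 => /andP[/eqP].
  apply: psdmx_kernel => //; rewrite -mulmxA mul_block_col Qx !mulmx0 !add0r.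
  by rewrite tr_col_mx map_row_mx mul_row_col mulmx0 trmx0 map_mx0 mul0mx addr0 mxE.
exists (char_poly (h *m pinvmx (Q + Q))^T); first exact/monic_neq0/char_poly_monic.
move=> t nt; pose W : 'M[R[i]]_(n + n, n) := col_mx 1%:M (- t%:C%:M).
pose K := W^t* *m M *m W.
have pK : psdmx K by exact: psdmx_congr.
have MW : M *m W = col_mx (P + P - t%:C *: h) (h - t%:C *: (Q + Q)).
  by rewrite mul_block_col !mulmx1 !mulmxN !mul_mx_scalar.
have WE : W^t* = row_mx 1%:M (- t%:C%:M).
  rewrite tr_col_mx map_row_mx trmx1 map_mx1; congr row_mx.
  rewrite adjmxN tr_scalar_mx map_scalar_mx.
  by congr (- _%:M); exact: conjc_real.
have KE : K = P + P - t%:C *: h - t%:C *: h + t%:C ^+ 2 *: (Q + Q).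
  rewrite /K -mulmxA MW WE mul_row_col mul1mx mulNmx mul_scalar_mx scalerBr opprB.
  by rewrite scalerA -expr2 addrA addrAC.
(* If [K v = 0], then [W v] is isotropic for [M], so [M W v = 0]; its lower half is the pencil
   equation for [h] and [Q + Q]. *)
have KQ (v : 'cV_n) : K *m v = 0 -> (Q + Q) *m v = 0.
  move=> Kv; apply: pencil_eigenvalue nt => //.
  have /eqP : M *m (W *m v) = 0.
    apply: psdmx_kernel => //.
    have -> : (W *m v)^t* *m M *m (W *m v) = v^t* *m (K *m v).
      by rewrite /K adjmxM !mulmxA.
    by rewrite Kv mulmx0 mxE.
  by rewrite mulmxA MW mul_col_mx col_mx_eq0 => /andP[_ /eqP].
have [e0 e00 pe] := psdmx_dominates pK (psdmx_herm pQ2) KQ.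
exists e0; first exact: e00.
move=> e /andP[e_ge0 le_e].
(* A smaller [e] adds back a positive multiple of [Q]; the halving below undoes the doubling of the
   diagonal blocks. *)
have pe' : psdmx (K - e0%:C *: (Q + Q) + (e0 - e)%:C *: (Q + Q)).
  by apply: (psdmxD pe); apply: psdmxZ pQ2; rewrite subr_ge0.
have half0 : 0 <= 2^-1 :> R by rewrite invr_ge0.
have := psdmxZ half0 pe'; rewrite KE fmorphV rmorph_nat.
by rewrite !(rmorphB, rmorphXn) half_pencilE.
Qed.

(** The product [q] has fewer than [size q] roots, so it misses one of the integers
    [0, ..., size q - 1]. *)
Lemma exists_nonroot (I : finType) (p : I -> {poly R[i]}) :
  (forall j, p j != 0) -> exists t : R, forall j, ~~ root (p j) t%:C.
Proof.
move=> p0; pose q := \prod_j p j.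
have q0 : q != 0 by apply/prodf_neq0 => j _; exact: p0.
pose s : seq R[i] := [seq (k%:R : R)%:C | k <- iota 0 (size q)].
have us : uniq s.
  rewrite map_inj_uniq ?iota_uniq // => a b /complexI /eqP.
  by rewrite eqr_nat => /eqP.
have /allPn[_ /mapP[k _ ->] nr] : ~~ all (root q) s.
  apply/negP => /(fun a => max_poly_roots q0 a us).
  by rewrite size_map size_iota ltnn.
by exists k%:R => j; move: nr; rewrite /q (bigD1 j) //= rootM negb_or => /andP[].
Qed.
End Psd.

(** * The subsystem cut out by a functional *)

Section Slice.
Variables (R : realType) (V : starVect R) (C : conefamily V) (u : V).
Variables (psi : V -> R[i]) (c : R).
Arguments C : clear implicits.
Hypotheses (sysC : is_operator_system C u) (c0 : 0 < c) (psi_u : psi u = c%:C).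
Hypothesis psi_linear : linear (psi : V -> R[i]^o).
Hypothesis psi_star : forall v, psi (star v) = Num.conj (psi v).

(** The competitor in the minimality argument. Imposing positivity of [psi] entrywise at every level
    makes it stable under compression. *)
Definition slice : conefamily V :=
  fun s => C s `&` [set A | psdmx (map_mx psi A)].

Let psiF : {linear V -> R[i]^o} :=
  HB.pack (psi : V -> R[i]^o) (GRing.isLinear.Build _ _ _ _ (psi : V -> R[i]^o) psi_linear).

Let psiD x y : psi (x + y) = psi x + psi y.
Proof. exact: (linearD psiF). Qed.

Let psiZ (a : R[i]) x : psi (a *: x) = a * psi x.
Proof. exact: (linearZ_LR psiF). Qed.

Let psi_sum (I : finType) (F : I -> V) : psi (\sum_k F k) = \sum_k psi (F k).
Proof. exact: (linear_sum psiF). Qed.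

Lemma map_tens s (B : 'M[R[i]]_s) : map_mx psi (tens u B) = c%:C *: B.
Proof. by apply/matrixP => a b; rewrite !mxE psiZ psi_u mulrC. Qed.

Lemma map_compress s t (W : 'M[R[i]]_(s, t)) (A : 'M[V]_s) :
  map_mx psi (compress W A) = W^t* *m map_mx psi A *m W.
Proof.
apply/matrixP => a b; rewrite !mxE psi_sum.
under eq_bigr do rewrite psi_sum.
rewrite exchange_big; apply: eq_bigr => l _ /=; rewrite mxE mulr_suml.
by apply: eq_bigr => k _; rewrite psiZ !mxE mulrAC.
Qed.

(** The order unit property at [A = 0] yields one positive multiple of the unit; rescaling gives the
    others. *)
Lemma opsys_unit_multiple s x : (0 < s)%N -> 0 <= x -> C s (tens u x%:C%:M).
Proof.
move=> s0 x0; have [|r r0] := opsys_order_unit sysC s0 (A := 0).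
  by apply/matrixP => a b; rewrite !mxE -[X in star X](scale0r u) starZ rmorph0 scale0r.
rewrite addr0 => /(opsys_scale sysC s0 (divr_ge0 x0 (ltW r0))); congr C.
apply/matrixP => a b; rewrite !mxE scalerA; congr (_ *: _).
by rewrite mulrnAr -rmorphM divfK // gt_eqF.
Qed.

Lemma slice_is_operator_system : is_operator_system slice u.
Proof.
split.
- by move=> s A s0 [/(opsys_herm sysC s0)].
- move=> s s0; rewrite (_ : [set _ | _ in _] = [set coordmx A | A in C s] `&`
    [set M : 'M['rV[R[i]^o]_(dim V)]_s |
       psdmx (map_mx (fun v : 'rV[R[i]]_(dim V) => psi (r2v v)) M)]).
    have clC := opsys_closed sysC s0; apply: closedI; first exact: clC.
    apply: closed_psdmx => p q; under eq_fun do rewrite mxE.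
    exact: (@vcoord_continuous R[i] V s psiF).
  have mapK (A : 'M[V]_s) : map_mx (fun v : 'rV[R[i]]_(dim V) => psi (r2v v)) (coordmx A)
      = map_mx psi A by apply/matrixP => a b; rewrite !mxE v2rK.
  apply/seteqP; split=> M /=.
    by move=> [A [CA pA] <-]; split; [exists A|rewrite mapK].
  by move=> [[A CA <-]]; rewrite mapK => pA; exists A.
- move=> s A B s0 [CA pA] [CB pB]; split; first exact: (opsys_add sysC).
  rewrite /= (_ : map_mx _ _ = map_mx psi A + map_mx psi B).
    exact: (psdmxD pA pB).
  by apply/matrixP => a b; rewrite !mxE psiD.
- move=> s r A s0 r0 [CA pA]; split; first exact: (opsys_scale sysC).
  rewrite /= (_ : map_mx _ _ = r%:C *: map_mx psi A); first exact: (psdmxZ r0 pA).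
  by apply/matrixP => a b; rewrite !mxE psiZ.
- by move=> s A s0 [CA _] [CN _]; exact: (opsys_salient sysC s0).
- split; first exact: opsys_unit sysC.
  by rewrite /= map_tens; apply: psdmxZ (psdmx1 _ _); exact: ltW.
- move=> s t W A s0 t0 [CA pA]; split; first exact: (opsys_compress sysC).
  by rewrite /= map_compress; exact: (psdmx_congr _ pA).
- move=> s A s0 hA; have [r r0 Cr] := opsys_order_unit sysC s0 hA.
  have [|r' r'0 pr] := @psdmx_order_unit R s (map_mx psi A).
    by apply/matrixP => a b; rewrite !mxE -psi_star -[in RHS]hA mxE.
  have rc0 : 0 < r' / c by rewrite divr_gt0.
  (* [r] brings [A] into [C], and [r' / c] makes [psi] positive since [psi u = c]; the surplus in
     each condition is positive. *)
  exists (r + r' / c); first exact: addr_gt0.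
  have tensD : tens u (r + r' / c)%:C%:M = (tens u r%:C%:M + tens u (r' / c)%:C%:M : 'M[V]_s).
    by apply/matrixP => a b; rewrite !mxE -scalerDl -mulrnDl -rmorphD.
  split.
    rewrite tensD addrAC; apply: (opsys_add sysC) => //.
    by apply: opsys_unit_multiple => //; exact: ltW.
  rewrite /= tensD (_ : map_mx _ _ =
      c%:C *: (r%:C%:M) + (c%:C *: (r' / c)%:C%:M + map_mx psi A)); last first.
    by rewrite -!map_tens; apply/matrixP => a b; rewrite !mxE !psiD -addrA.
  apply: psdmxD.
    rewrite -scalemx1; apply: psdmxZ; first exact: ltW.
    by apply: psdmxZ (psdmx1 _ _); exact: ltW.
  by rewrite scale_scalar_mx -rmorphM mulrC divfK // gt_eqF.
Qed.

End Slice.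

(** * The pencil functional and its rank-one witness *)

Section Pencil.
Variables (R : realType) (d : nat) (i0 i1 : 'I_d).
Implicit Types (t e : R) (X : 'M[R[i]]_d).

(** The quadratic form of the corner at the vector [(1, -t)], lowered by [e X11]. *)
Definition pencil t e X : R[i] :=
  X i0 i0 - t%:C * (X i0 i1 + X i1 i0) + (t ^+ 2 - e)%:C * X i1 i1.

Lemma pencil_linear t e : linear (pencil t e : Mat R d -> R[i]^o).
Proof.
move=> a X Y; rewrite -[a *: pencil _ _ _]/(a * pencil t e X) /pencil !mxE; ring.
Qed.

Lemma pencil_star t e (X : Mat R d) : pencil t e (star X) = Num.conj (pencil t e X).
Proof.
have cR (x : R) : Num.conj x%:C = x%:C by exact: conjc_real.
have conjE (x y y' z u v : R[i]) : Num.conj (x - u * (y + y') + v * z) =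
    Num.conj x - Num.conj u * (Num.conj y + Num.conj y') + Num.conj v * Num.conj z.
  by rewrite rmorphD rmorphB !rmorphM rmorphD.
by rewrite /pencil conjE !cR !mxE [X in _ * X]addrC.
Qed.

Definition entry s (A : 'M[Mat R d]_s) (a b : 'I_d) : 'M[R[i]]_s :=
  \matrix_(k, l) (A k l : 'M[R[i]]_d) a b.

Lemma entry_kron s (A : 'M[Mat R d]_s) : psdmx (kron A) ->
  psdmx (block_mx (entry A i0 i0) (entry A i0 i1) (entry A i1 i0) (entry A i1 i1)).
Proof.
pose f (p : 'I_(s + s)) := mxtens.mxtens_index
  (match fintype.split p with inl k => (i0, k) | inr k => (i1, k) end).
move=> /(psdmx_mxsub f); congr psdmx.
apply/matrixP => p q; rewrite !mxE !mxtens.mxtens_indexK.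
by case: (fintype.split p) => k; rewrite !mxE; case: (fintype.split q) => l; rewrite !mxE.
Qed.

(** Partial transposition swaps the off-diagonal blocks of the corner, so double positivity supplies
    both hypotheses of [block_pencil_psd]. *)
Lemma Dpsd_pencil s (A : 'M[Mat R d]_s) : Dpsd A ->
  exists2 p : {poly R[i]}, p != 0 & forall t, ~~ root p t%:C ->
    exists2 e0, 0 < e0 & forall e, 0 <= e <= e0 -> psdmx (map_mx (pencil t e) A).
Proof.
move=> [/entry_kron pA /entry_kron gA].
have [|p p0 pt] := block_pencil_psd pA.
  by move: gA; congr psdmx; congr block_mx; apply/matrixP => a b; rewrite !mxE.
exists p; first exact: p0.
move=> t /pt[e0 e00 pe]; exists e0; first exact: e00.
move=> e /pe; congr psdmx; apply/matrixP => a b.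
by rewrite !mxE.
Qed.

Definition gram_row t : 'rV[R[i]]_d := t%:C *: delta_mx 0 i0 + delta_mx 0 i1.

Definition gram t : 'M[R[i]]_d := (gram_row t)^t* *m gram_row t.

Lemma gram_rowE t : (gram_row t)^t* = (gram_row t)^T.
Proof.
apply/matrixP => a b; rewrite !mxE rmorphD rmorphM !rmorph_nat.
by congr (_ * _ + _); exact: conjc_real.
Qed.

(** As [gram_row] is real, this form ignores transposition, so it is nonnegative on decomposable
    matrices at level 1. *)
Definition quad t X : R[i] := (gram_row t *m X *m (gram_row t)^T) 0 0.

Lemma quadD t X Y : quad t (X + Y) = quad t X + quad t Y.
Proof. by rewrite /quad mulmxDr mulmxDl mxE. Qed.

Lemma quadN t X : quad t (- X) = - quad t X.
Proof. by rewrite /quad mulmxN mulNmx mxE. Qed.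

Lemma quadZ t a X : quad t (a *: X) = a * quad t X.
Proof. by rewrite /quad -scalemxAr -scalemxAl mxE. Qed.

Lemma quad_tr t X : quad t X^T = quad t X.
Proof. by rewrite /quad -[in RHS]trace_mx11 -mxtrace_tr !trmx_mul trmxK mulmxA trace_mx11. Qed.

Lemma quad_delta t a b : quad t (delta_mx a b) = gram_row t 0 a * gram_row t 0 b.
Proof.
rewrite /quad -(mul_delta_mx (0 : 'I_1)) mulmxA -mulmxA -colE -rowE mxE big_ord1.
by rewrite [col _ _ _ _]mxE [row _ _ _ _]mxE [_^T _ _]mxE.
Qed.

Lemma quad_ge0 t X : psdmx X -> 0 <= quad t X.
Proof. by move=> [_ /(_ (gram_row t)^T)]; rewrite -[in X in X^t*]gram_rowE trmxCK. Qed.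

Hypothesis i01 : i0 != i1.

Lemma gram_row_i0 t : gram_row t 0 i0 = t%:C.
Proof. by rewrite !mxE !eqxx (negPf i01) mulr1 addr0. Qed.

Lemma gram_row_i1 t : gram_row t 0 i1 = 1.
Proof. by rewrite !mxE !eqxx eq_sym (negPf i01) mulr0 add0r. Qed.

(** The vectors [(1, -t)] and [(t, 1)] are orthogonal, so only the correction by [e] survives. *)
Lemma pencil_gram t e : pencil t e (gram t) = - e%:C.
Proof.
have gE a b : gram t a b = gram_row t 0 a * gram_row t 0 b.
  by rewrite /gram gram_rowE mxE big_ord1 [_^T _ _]mxE.
rewrite /pencil !gE gram_row_i0 gram_row_i1 rmorphB rmorphXn; ring.
Qed.

Lemma gram_sym t : (gram t)^T = gram t.
Proof. by rewrite /gram gram_rowE trmx_mul trmxK. Qed.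

Lemma Dpsd_gram t : @Dpsd R d 1 (const_mx (gram t)).
Proof.
have pg : @Psd R d 1 (const_mx (gram t)).
  have := psdmx_mxsub (fun p : 'I_(d * 1) => (mxtens.mxtens_unindex p).1)
    (psdmx_gram (gram_row t)).
  by congr psdmx; apply/matrixP => a b; rewrite !mxE.
split; first exact: pg.
rewrite /PsdG (_ : ptrans _ = const_mx (gram t)); first exact: pg.
by apply/matrixP => a b; rewrite !mxE gram_sym.
Qed.

End Pencil.

Lemma Psd_level1 (R : realType) d (A : 'M[Mat R d]_1) : Psd A -> psdmx (A 0 0 : 'M[R[i]]_d).
Proof.
move=> /(psdmx_mxsub (fun p : 'I_d => mxtens.mxtens_index (p, 0 : 'I_1))); congr psdmx.
by apply/matrixP => a b; rewrite !mxE !mxtens.mxtens_indexK.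
Qed.

Lemma adjmx_delta (R : realType) m n (a : 'I_m) (b : 'I_n) :
  (delta_mx a b : 'M[R[i]]_(m, n))^t* = delta_mx b a.
Proof. by rewrite trmx_delta; apply/matrixP => p q; rewrite !mxE rmorph_nat. Qed.

(** * Finite generation of the doubly positive system *)

Section NotFinitelyGenerated.
Variables (R : realType) (d : nat) (i0 i1 : 'I_d).
Hypothesis i01 : i0 != i1.

Lemma Dpsd_not_finitely_generated : ~ finitely_generated (@Dpsd R d) (1%:M : Mat R d).
Proof.
move=> [n [sz [A [sz0 sysC genA minC]]]].
have /boolp.choice[p pP] j : exists p : {poly R[i]}, p != 0 /\ forall t : R, ~~ root p t%:C ->
    exists2 e0 : R, 0 < e0 & forall e, 0 <= e <= e0 -> psdmx (map_mx (pencil i0 i1 t e) (A j)).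
  by have [p p0 pt] := Dpsd_pencil i0 i1 (genA j); exists p.
have [t nt] := exists_nonroot (fun j => (pP j).1).
have /boolp.choice[e0 e0P] j : exists e0 : R, 0 < e0 /\ forall e, 0 <= e <= e0 ->
    psdmx (map_mx (pencil i0 i1 t e) (A j)).
  by have [e0 e00 pe] := (pP j).2 t (nt j); exists e0.
(* The default [2^-1] keeps the functional positive at the unit, and covers an empty list of
   generators. *)
pose e := \big[Order.min/(2^-1 : R)]_j e0 j.
have e_gt0 : 0 < e.
  by apply/bigmin_gtP; split=> [|j _]; [rewrite invr_gt0|exact: (e0P j).1].
have e_le j : e <= e0 j by exact: bigmin_le.
have e_half : e <= 2^-1 by exact: bigmin_le_id.
have c0 : 0 < 1 + (t ^+ 2 - e).
  by have := sqr_ge0 t; move: e_half; lra.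
have pencil1 : pencil i0 i1 t e 1%:M = (1 + (t ^+ 2 - e))%:C.
  rewrite /pencil !mxE !eqxx (negPf i01) eq_sym (negPf i01) !(addr0, mulr0, subr0) mulr1.
  by rewrite [RHS]rmorphD.
have sysD := slice_is_operator_system (@Dpsd_is_operator_system R d) c0 pencil1
  (pencil_linear i0 i1 t e) (pencil_star i0 i1 t e).
have genD : contains_generators (slice (@Dpsd R d) (pencil i0 i1 t e)) A.
  by move=> j; split; [exact: genA|apply: (e0P j).2; rewrite ltW // e_le].
(* Minimality would put [gram t] into the slice, where the functional takes the value [-e] on it. *)
have [_ [_ /(_ 1%:M)]] := minC _ _ sysD genD 1%N isT _ (Dpsd_gram i0 i1 t).
rewrite trmx1 map_mx1 mul1mx mulmx1 !mxE pencil_gram // oppr_ge0.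
by rewrite -[0]/(0%:C) lecR leNgt e_gt0.
Qed.

End NotFinitelyGenerated.

(** * Realizations of the decomposable system *)

Section NotRealizable.
Variables (R : realType) (d : nat) (i0 i1 : 'I_d).
Hypothesis i01 : i0 != i1.

Let E (a b : 'I_2) : 'M[R[i]]_d :=
  delta_mx (if a == 0 then i0 else i1) (if b == 0 then i0 else i1).

(** Here the outer block index is the level index, whereas in [entry_kron] it is the index of
    [Mat R d]. *)
Lemma kron_block m (B : 'M[Mat R m]_2) : psdmx (kron B) ->
  psdmx (block_mx (B 0 0 : 'M[R[i]]_m) (B 0 1) (B 1 0) (B 1 1)).
Proof.
pose f (p : 'I_(m + m)) := mxtens.mxtens_index
  (match fintype.split p with inl k => (k, 0 : 'I_2) | inr k => (k, 1 : 'I_2) end).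
move=> /(psdmx_mxsub f); congr psdmx.
apply/matrixP => p q; rewrite !mxE !mxtens.mxtens_indexK.
by case: (fintype.split p) => k; rewrite !mxE; case: (fintype.split q).
Qed.

(** The rank-one matrix of [e_i0 (x) e_0 + e_i1 (x) e_1]; applying [phi] entrywise gives the Choi
    matrix of [phi] on the corner. *)
Let choi : 'M[Mat R d]_2 := \matrix_(a, b) E a b.

Lemma Psd_choi : Psd choi.
Proof.
pose w : 'rV[R[i]]_(d * 2) := \row_p
  ((mxtens.mxtens_unindex p).1 == if (mxtens.mxtens_unindex p).2 == 0 then i0 else i1)%:R.
rewrite /Psd (_ : kron choi = w^t* *m w); first exact: psdmx_gram.
by apply/matrixP => p q; rewrite [RHS]mxE big_ord1 !mxE rmorph_nat -natrM mulnb.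
Qed.

Lemma Psd0 s : @Psd R d s 0.
Proof.
rewrite /Psd (_ : kron 0 = 0%:C *: 1%:M); first exact: psdmxZ (lexx _) (psdmx1 _ _).
by rewrite scale0r; apply/matrixP => p q; rewrite !mxE.
Qed.

Lemma ptransK s (A : 'M[Mat R d]_s) : ptrans (ptrans A) = A.
Proof. by apply/matrixP => a b; rewrite !mxE trmxK. Qed.

Lemma Decomp_choi : Decomp choi.
Proof.
exists choi, 0; split; [exact: Psd_choi| |by rewrite addr0].
rewrite /PsdG (_ : ptrans 0 = 0); first exact: Psd0.
by apply/matrixP => a b; rewrite !mxE trmx0.
Qed.

Lemma Decomp_ptrans_choi : Decomp (ptrans choi).
Proof.
exists 0, (ptrans choi); split; [exact: Psd0| |by rewrite add0r].
by rewrite /PsdG ptransK; exact: Psd_choi.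
Qed.

Lemma mstar_choi : mstar choi = choi.
Proof.
apply/matrixP => a b; rewrite !mxE; apply/matrixP => p q; rewrite !mxE rmorph_nat.
by rewrite andbC.
Qed.

Lemma Decomp_not_realizable : ~ fd_realizable (@Decomp R d) (1%:M : Mat R d).
Proof.
move=> [m [phi [phi_star phi1 phiP]]].
have hT : mstar (ptrans choi) = ptrans choi by rewrite -ptrans_mstar mstar_choi.
(* [choi] and its partial transpose are both decomposable, so [phi] yields the block matrix and its
   swap required by [block_pencil_psd]. *)
have b1 := kron_block ((phiP 2%N choi isT mstar_choi).1 Decomp_choi).
have b2 := kron_block ((phiP 2%N (ptrans choi) isT hT).1 Decomp_ptrans_choi).
have mE (A : 'M[Mat R d]_2) a b : map_mx phi A a b = phi (A a b) by rewrite mxE.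
have chE a b : choi a b = E a b by rewrite mxE.
have tchE a b : ptrans choi a b = E b a by rewrite !mxE trmx_delta.
rewrite !mE !chE in b1; rewrite !mE !tchE in b2.
have [p p0 pt] := block_pencil_psd b1 b2.
have [t /(_ tt) nt] := @exists_nonroot R unit (fun _ => p) (fun _ => p0).
have [e e_gt0 /(_ e)] := pt t nt; rewrite lexx ltW // => /(_ isT) pe.
(* The matrix of the pencil functional: [phi Z] is positive by the choice of [t] and [e], so the
   realization forces [Z] to be decomposable. *)
pose Z : Mat R d := E 0 0 - t%:C *: (E 0 1 + E 1 0) + (t ^+ 2 - e)%:C *: E 1 1.
have phiZ : phi Z = phi (E 0 0) - t%:C *: (phi (E 0 1) + phi (E 1 0))
    + (t ^+ 2 - e)%:C *: phi (E 1 1).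
  have phiD (x y : 'M[R[i]]_d) : phi (x + y) = phi x + phi y := linearD phi x y.
  have phiN (x : 'M[R[i]]_d) : phi (- x) = - phi x := linearN phi x.
  have phisc (a : R[i]) (x : 'M[R[i]]_d) : phi (a *: x) = a *: phi x := linearZ_LR phi a x.
  by rewrite /Z phiD phiD phiN !phisc phiD.
rewrite -phiZ in pe.
have hZ : mstar (const_mx Z : 'M[Mat R d]_1) = const_mx Z.
  have conjE (x : R) : Num.conj x%:C = x%:C by exact: conjc_real.
  have ZE : ((Z : 'M[R[i]]_d)^t* = Z).
    rewrite /Z adjmxD adjmxD adjmxN 2!adjmxZ adjmxD !adjmx_delta 2!conjE.
    by rewrite [X in _ *: X]addrC.
  by apply/matrixP => a b; rewrite !mxE.
have [X [Y [pX pY ZE]]] : Decomp (const_mx Z : 'M[Mat R d]_1).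
  apply/(phiP 1%N _ isT hZ).
  have := psdmx_mxsub (fun p : 'I_(m * 1) => (mxtens.mxtens_unindex p).1) pe.
  by congr psdmx; apply/matrixP => a b; rewrite !mxE.
(* Contradiction through [quad]: its value at [Z] is [-e], but it is nonnegative on both
   summands. *)
have := congr1 (fun B : 'M[Mat R d]_1 => quad i0 i1 t (B 0 0)) ZE.
rewrite !mxE !quadD quadN !quadZ quadD !quad_delta.
rewrite gram_row_i0 // gram_row_i1 // => qE.
have : 0 <= - e%:C.
  have -> : - e%:C = quad i0 i1 t (X 0 0) + quad i0 i1 t (Y 0 0).
    by rewrite -qE rmorphB rmorphXn; ring.
  rewrite addr_ge0 //; first exact/quad_ge0/Psd_level1.
  rewrite -quad_tr; have := Psd_level1 pY; rewrite mxE.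
  exact: quad_ge0.
by rewrite oppr_ge0 -[0]/(0%:C) lecR leNgt e_gt0.
Qed.

End NotRealizable.

Theorem theorem3p1 (R : realType) (d : nat) (hd : (2 <= d)%N) :
  ~ fd_realizable (@Decomp R d) (1%:M : Mat R d) /\
  ~ finitely_generated (@Dpsd R d) (1%:M : Mat R d).
Proof.
pose i0 : 'I_d := Ordinal (ltnW hd); pose i1 : 'I_d := Ordinal hd.
have i01 : i0 != i1 by [].
split; first exact: Decomp_not_realizable i01.
exact: Dpsd_not_finitely_generated i01.
Qed.
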